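(* Let $k,n$ be positive integers. Every $(\sqcap,\sqcup)$-closed set $M\subseteq {S_k}^n$, regarded as a poset with the order $\preceq$, is a median semilattice.
   Context: For a positive integer $k$ let $S_k=\{0,1,\dots,k\}$, partially ordered by: $a\preceq b$ if and only if $a\in\{0,b\}$. The product ${S_k}^n$ has the componentwise (direct product) order, also denoted $\preceq$; subsets of ${S_k}^n$ carry the induced order. For $x,y\in{S_k}^n$ define $x\sqcap y$ and $x\sqcup y$ componentwise: if $x_i,y_i$ are comparable in $\preceq$, then $(x\sqcap y)_i=\min\{x_i,y_i\}$ and $(x\sqcup y)_i=\max\{x_i,y_i\}$ (min and max with respect to $\preceq$); if $x_i,y_i$ are incomparable, then $(x\sqcap y)_i=(x\sqcup y)_i=0$. A nonempty subset of ${S_k}^n$ is $(\sqcap,\sqcup)$-closed if it is closed under both operations. A median semilattice is a meet-semilattice $L=(L,\le)$ such that (MS1) every principal ideal $\{y\in L: y\le x\}$ is a distributive lattice, and (MS2) for all $x,y,z\in L$, if $x\vee y$, $y\vee z$ and $z\vee x$ exist, then $x\vee y\vee z$ exists in $L$. *)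

(* Defs.v *)
From HB Require Import structures.
From mathcomp Require Import all_boot all_order.
From mathcomp Require Import boolp classical_sets.

Set Implicit Arguments.
Unset Strict Implicit.
Unset Printing Implicit Defensive.

Import Order.TTheory.
Local Open Scope classical_set_scope.
Local Open Scope order_scope.

(* S_k = {0, ..., k} with bottom 0 and all other elements pairwise
   incomparable.  The alias keeps this order apart from the usual total order
   on 'I_k.+1. *)
Definition star (k : nat) : Type := 'I_k.+1.

HB.instance Definition _ (k : nat) := Finite.on (star k).

Definition star0 (k : nat) : star k := @ord0 k.

Definition star_le (k : nat) : rel (star k) :=
  fun a b => a \in [:: star0 k; b].

Fact star_le_refl k : reflexive (@star_le k).
Proof. by move=> a; rewrite /star_le !inE eqxx orbT. Qed.

Fact star_le_anti k : antisymmetric (@star_le k).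
Proof.
move=> a b /andP[]; rewrite /star_le !inE => /orP[/eqP->|/eqP//].
by case/orP => /eqP.
Qed.

Fact star_le_trans k : transitive (@star_le k).
Proof.
move=> b a c; rewrite /star_le !inE => /orP[->//|/eqP->]; exact.
Qed.

Fact star_display : Order.disp_t. Proof. exact: Order.Disp tt tt. Qed.

HB.instance Definition _ (k : nat) := Order.Le_isPOrder.Build star_display
  (star k) (@star_le_refl k) (@star_le_anti k) (@star_le_trans k).

Definition sqcap (k : nat) (a b : star k) : star k :=
  if a >=< b then Order.min a b else star0 k.

Definition sqcup (k : nat) (a b : star k) : star k :=
  if a >=< b then Order.max a b else star0 k.

(* Functions carry the pointwise order in boolp, so 'I_n -> star k is the
   direct product of n copies of star k. *)
Definition cap_cup_closed (k n : nat) (M : set ('I_n -> star k)) : Prop :=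
  M !=set0 /\
  forall x y, M x -> M y ->
    M (fun i => sqcap (x i) (y i)) /\ M (fun i => sqcup (x i) (y i)).

HB.instance Definition _ (T : choiceType) (A : set T) :=
  SubChoice.copy (set_type A) {x : T | x \in A}.

HB.instance Definition _ d (T : porderType d) (A : set T) :=
  [SubChoice_isSubPOrder of set_type A by <: with d].

Definition order_isomorphic d (P : porderType d) d' (Q : porderType d') : Prop :=
  exists f : P -> Q, bijective f /\ {mono f : x y / x <= y}.

(* A poset "is" a meet-semilattice (resp. distributive lattice) when its order
   is, up to isomorphism, the order of such a structure of the library.  The
   operations are determined by the order, so no data is chosen here. *)
Definition is_meet_semilattice d (P : porderType d) : Prop :=
  exists d' (L : meetSemilatticeType d'), order_isomorphic P L.

Definition is_distributive_lattice d (P : porderType d) : Prop :=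
  exists d' (L : distrLatticeType d'), order_isomorphic P L.

Definition has_join d (P : porderType d) (A : set P) : Prop :=
  exists s, isLub A s.

Definition principal_ideal d (P : porderType d) (x : P) : set P :=
  [set y | y <= x].

Record median_semilattice d (P : porderType d) : Prop := MedianSemilattice {
  median_meet : is_meet_semilattice P;
  median_ideal : forall x : P,
    is_distributive_lattice (principal_ideal x : porderType d);
  median_join : forall x y z : P,
    has_join [set x; y] -> has_join [set y; z] -> has_join [set z; x] ->
    has_join [set x; y; z]
}.

(* Main.v *)
From HB Require Import structures.
Require Import Defs.
From mathcomp Require Import all_boot all_order.
From mathcomp Require Import boolp classical_sets.

Set Implicit Arguments.
Unset Strict Implicit.
Unset Printing Implicit Defensive.

(** The order of a star has height one: two elements are comparable exactly
    when one of them is the bottom [star0] or they coincide.  Hence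

    - [sqcap] is the meet of the star, whether or not its arguments are
      comparable ([le_sqcap]): two incomparable elements have only [star0]
      below them;
    - [sqcup] is the join of any two comparable elements ([sqcup_le]), and two
      elements are comparable as soon as they have an upper bound
      ([star_bounded_comparable]).

    Both facts pass to functions pointwise.  A closed set M is therefore a
    meet-semilattice under the pointwise [sqcap].  Inside a principal ideal
    everything is bounded, so both operations stay in the ideal and are its meet
    and join; they distribute because each coordinate ranges over a chain with
    at most two elements.  For the last axiom, pairwise joins of x, y, z in M
    make x, y, z pairwise comparable in each coordinate; then [sqcup x y], which
    is x or y in each coordinate, is again comparable with z, so
    [sqcup (sqcup x y) z] is the join of the three, and it lies in M. *)

Section LatticeRecognition.
Import Order.TTheory.
Local Open Scope order_scope.

Lemma is_meet_semilattice_of_meet (d : Order.disp_t) (P : porderType d)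
    (m : P -> P -> P) :
  (forall x y z, (x <= m y z) = (x <= y) && (x <= z)) ->
  is_meet_semilattice P.
Proof.
case: P m => T c m mP; pose P := Order.POrder.Pack c.
pose mMixin := Order.POrder_isMeetSemilattice.Build d P mP.
pose L : meetSemilatticeType d := HB.pack T P mMixin.
by exists d, L, id; split=> //; exists id.
Qed.

Lemma is_distributive_lattice_of_meet_join (d : Order.disp_t)
    (P : porderType d) (m j : P -> P -> P) :
    (forall x y z, (x <= m y z) = (x <= y) && (x <= z)) ->
    (forall x y z, (j x y <= z) = (x <= z) && (y <= z)) ->
    left_distributive m j ->
  is_distributive_lattice P.
Proof.
case: P m j => T c m j mP jP mjDl; pose P := Order.POrder.Pack c.
pose mMixin := Order.POrder_isMeetSemilattice.Build d P mP.
pose jMixin := Order.POrder_isJoinSemilattice.Build d P jP.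
pose L : latticeType d := HB.pack T P mMixin jMixin.
pose dMixin := Order.Lattice_Meet_isDistrLattice.Build d L mjDl.
pose D : distrLatticeType d := HB.pack T L dMixin.
by exists d, D, id; split=> //; exists id.
Qed.

End LatticeRecognition.

Section Star.
Import Order.TTheory.
Local Open Scope order_scope.
Variable k : nat.
Implicit Types a b c s : star k.

Lemma star_leE a b : (a <= b) = (a == star0 k) || (a == b).
Proof. by rewrite -[a <= b]/(a \in [:: star0 k; b]) !inE. Qed.

Lemma star0_le a : star0 k <= a.
Proof. by rewrite star_leE eqxx. Qed.

Lemma star_bounded_comparable a b s : a <= s -> b <= s -> a >=< b.
Proof.
rewrite /Order.comparable !star_leE.
by case/orP=> /eqP->; [rewrite eqxx | case/orP=> /eqP->; rewrite !eqxx ?orbT].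
Qed.

(** When b and c are incomparable, both inequalities on the right force
    a = [star0]: a nonzero lower bound of b and c would equal both. *)
Lemma le_sqcap a b c : (a <= sqcap b c) = (a <= b) && (a <= c).
Proof.
rewrite /sqcap; case: ifP => [bc | /negP bc]; first exact: comparable_le_min.
apply/idP/andP => [a0 | [ab ac]]; first by split; apply: le_trans a0 (star0_le _).
move: ab; rewrite !star_leE => /orP[-> // | /eqP ab].
by case: bc; rewrite /Order.comparable -ab ac.
Qed.

Lemma sqcup_le a b c : a >=< b -> (sqcup a b <= c) = (a <= c) && (b <= c).
Proof. by move=> ab; rewrite /sqcup ab comparable_ge_max. Qed.

(** Here [sqcup a b] is one of a and b. This is what reduces the existence of a
    triple join to that of the pairwise ones. *)
Lemma sqcup_comparable a b c :
  a >=< b -> b >=< c -> a >=< c -> sqcup a b >=< c.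
Proof.
by move=> ab bc ac; rewrite /sqcup ab; apply: comparable_maxl.
Qed.

(** The elements below s are [star0] and s, so there are eight cases. The bound
    cannot be dropped: for distinct nonzero a and b, the choice c = a gives
    [star0] on the left and a on the right. *)
Lemma sqcap_sqcupDl s a b c : a <= s -> b <= s -> c <= s ->
  sqcap (sqcup a b) c = sqcup (sqcap a c) (sqcap b c).
Proof.
have s0 : s >=< star0 k by rewrite /Order.comparable star0_le orbT.
have z0 : star0 k >=< s by rewrite comparable_sym.
have m0 : Order.min s (star0 k) = star0 k by exact: min_r (star0_le s).
have m1 : Order.max s (star0 k) = s by exact: max_l (star0_le s).
have m2 : Order.min (star0 k) s = star0 k by exact: min_l (star0_le s).
have m3 : Order.max (star0 k) s = s by exact: max_r (star0_le s).
rewrite !star_leE => /orP[]/eqP-> /orP[]/eqP-> /orP[]/eqP->;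
  by rewrite /sqcap /sqcup ?(s0, z0, comparablexx, m0, m1, m2, m3, minxx, maxxx).
Qed.

End Star.

Section Functions.
Import Order.TTheory.
Local Open Scope order_scope.
Variables (k : nat) (I : Type).
Implicit Types f g h : I -> star k.

Definition fcap f g : I -> star k := fun i => sqcap (f i) (g i).
Definition fcup f g : I -> star k := fun i => sqcup (f i) (g i).

Definition pointwise_comparable f g := forall i, f i >=< g i.

Lemma le_fcap f g h : (f <= fcap g h) = (f <= g) && (f <= h).
Proof.
apply/lefP/andP => [fgh | [/lefP fg /lefP fh] i].
  by split; apply/lefP => i; move: (fgh i); rewrite le_sqcap => /andP[].
by rewrite le_sqcap fg fh.
Qed.

Lemma fcup_le f g h : pointwise_comparable f g ->
  (fcup f g <= h) = (f <= h) && (g <= h).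
Proof.
move=> fg; apply/lefP/andP => [fgh | [/lefP fh /lefP gh] i].
  by split; apply/lefP => i; move: (fgh i); rewrite sqcup_le // => /andP[].
by rewrite sqcup_le // fh gh.
Qed.

Lemma bounded_pointwise_comparable f g h :
  f <= h -> g <= h -> pointwise_comparable f g.
Proof.
by move=> /lefP fh /lefP gh i; apply: star_bounded_comparable (fh i) (gh i).
Qed.

Lemma fcap_fcupDl b f g h : f <= b -> g <= b -> h <= b ->
  fcap (fcup f g) h = fcup (fcap f h) (fcap g h).
Proof.
move=> /lefP fb /lefP gb /lefP hb; apply/funext => i.
exact: sqcap_sqcupDl (fb i) (gb i) (hb i).
Qed.

(** Stated for an order embedding v, so that a subset of the functions and a
    principal ideal of such a subset, a subtype of a subtype, are instances of
    the same form. *)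
Lemma embedded_meet_semilattice (d : Order.disp_t) (P : porderType d)
    (v : P -> I -> star k) (vP : {mono v : x y / x <= y})
    (vcap : forall x y, exists z, v z = fcap (v x) (v y)) :
  is_meet_semilattice P.
Proof.
pose m x y := sval (cid (vcap x y)).
have mE x y : v (m x y) = fcap (v x) (v y) by exact: svalP (cid (vcap x y)).
apply: (@is_meet_semilattice_of_meet _ _ m) => x y z.
by rewrite -!vP mE le_fcap.
Qed.

(** The bound b makes all values of v pointwise comparable, which is what turns
    [fcup] into a join and makes the operations distribute. *)
Lemma embedded_distributive_lattice (d : Order.disp_t) (P : porderType d)
    (v : P -> I -> star k) (vP : {mono v : x y / x <= y})
    (b : I -> star k) (vb : forall x, v x <= b)
    (vcap : forall x y, exists z, v z = fcap (v x) (v y))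
    (vcup : forall x y, exists z, v z = fcup (v x) (v y)) :
  is_distributive_lattice P.
Proof.
pose m x y := sval (cid (vcap x y)).
pose j x y := sval (cid (vcup x y)).
have mE x y : v (m x y) = fcap (v x) (v y) by exact: svalP (cid (vcap x y)).
have jE x y : v (j x y) = fcup (v x) (v y) by exact: svalP (cid (vcup x y)).
have v_inj : injective v.
  by move=> x y vxy; apply/le_anti; rewrite -!vP vxy lexx.
apply: (@is_distributive_lattice_of_meet_join _ _ m j) => x y z.
- by rewrite -!vP mE le_fcap.
- rewrite -!vP jE fcup_le //; exact: bounded_pointwise_comparable (vb x) (vb y).
- by apply: v_inj; rewrite mE !jE !mE (fcap_fcupDl (vb x) (vb y) (vb z)).
Qed.

End Functions.

Section ClosedSets.
Import Order.TTheory.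
Local Open Scope classical_set_scope.
Local Open Scope order_scope.
Variables (k n : nat) (M : set ('I_n -> star k)).
Hypothesis M_closed : cap_cup_closed M.
Implicit Types x y z : set_type M.

Lemma closed_fcap x y : exists z, val z = fcap (val x) (val y).
Proof.
have [_ /(_ _ _ (set_valP x) (set_valP y))[Mxy _]] := M_closed.
by exists (SigSub (mem_set Mxy)).
Qed.

Lemma closed_fcup x y : exists z, val z = fcup (val x) (val y).
Proof.
have [_ /(_ _ _ (set_valP x) (set_valP y))[_ Mxy]] := M_closed.
by exists (SigSub (mem_set Mxy)).
Qed.

Lemma closed_meet_semilattice : is_meet_semilattice (set_type M).
Proof. exact: embedded_meet_semilattice Order.le_val closed_fcap. Qed.

Lemma closed_ideal_distributive x :
  is_distributive_lattice (set_type (principal_ideal x)).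
Proof.
have ideal_le (u : set_type (principal_ideal x)) : val (val u) <= val x.
  rewrite Order.le_val; exact: set_valP u.
apply: (@embedded_distributive_lattice _ _ _ _ (fun u => val (val u)) _ (val x)).
- by move=> u w; rewrite !Order.le_val.
- exact: ideal_le.
- move=> u w; have [z zE] := closed_fcap (val u) (val w).
  have zx : principal_ideal x z.
    rewrite /principal_ideal /= -Order.le_val; apply: le_trans (ideal_le u).
    have : val z <= fcap (val (val u)) (val (val w)) by rewrite zE.
    by rewrite le_fcap => /andP[].
  by exists (SigSub (mem_set zx)).
- move=> u w; have [z zE] := closed_fcup (val u) (val w).
  have zx : principal_ideal x z.
    rewrite /principal_ideal /= -Order.le_val zE fcup_le ?ideal_le //.
    exact: bounded_pointwise_comparable (ideal_le u) (ideal_le w).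
  by exists (SigSub (mem_set zx)).
Qed.

Lemma has_join_pointwise_comparable x y :
  has_join [set x; y] -> pointwise_comparable (val x) (val y).
Proof.
case=> s [s_ub _].
by apply: (@bounded_pointwise_comparable _ _ _ _ (val s));
  rewrite Order.le_val; apply: s_ub; [left | right].
Qed.

Lemma closed_join3 x y z :
    has_join [set x; y] -> has_join [set y; z] -> has_join [set z; x] ->
  has_join [set x; y; z].
Proof.
move=> /has_join_pointwise_comparable xy /has_join_pointwise_comparable yz.
move=> /has_join_pointwise_comparable zx.
have [t tE] := closed_fcup x y; have [s sE] := closed_fcup t z.
have sP u : (s <= u) = [&& x <= u, y <= u & z <= u].
  rewrite -!Order.le_val sE fcup_le tE ?fcup_le ?andbA // => i.
  by apply: sqcup_comparable; rewrite // comparable_sym.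
exists s; split=> [w | u u_ub].
  have := lexx s; rewrite {1}sP => /and3P[xs ys zs].
  by case=> [[->|->]|->].
by rewrite sP !u_ub //; [right | left; right | left; left].
Qed.

End ClosedSets.

Theorem lemma3 (k n : nat) (hk : (0 < k)%N) (hn : (0 < n)%N)
    (M : set ('I_n -> star k)) (hM : cap_cup_closed M) :
  median_semilattice (set_type M).
Proof.
split.
- exact: closed_meet_semilattice.
- exact: closed_ideal_distributive.
- exact: closed_join3.
Qed.
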